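(* Let $\Psi$ be a rooted integral gain graph, let $e$ be a link of $\Psi$ that is not a root edge, and let $m$ be an integer. Then $$\chi^{\mathbb Z}_\Psi(m)=\chi^{\mathbb Z}_{\Psi\setminus e}(m)-\chi^{\mathbb Z}_{\Psi/e}(m).$$
   Context: An integral gain graph consists of a graph (loops and multiple edges allowed) and a gain function $\varphi$ assigning an integer to each oriented edge, with $\varphi(e^{-1})=-\varphi(e)$ when $e^{-1}$ is $e$ with the opposite orientation. The notation $g e_{ij}$ means an edge with endpoints $v_i,v_j$ whose gain in the direction from $v_i$ to $v_j$ is $g$. A link is an edge with two distinct endpoints. A rooted integral gain graph $\Psi$ is an integral gain graph with a distinguished root vertex $v_0$, such that for each nonroot vertex $v_i$ there is an integer $h_i$ for which the edges between $v_0$ and $v_i$ (root edges) are the edges $g e_{0i}$ with $g\in(-\infty,h_i]\subset\mathbb Z$; there are no other edges at $v_0$. The nonroot vertices and nonroot edges are finite in number. A rooted $m$-coloration of $\Psi$ is an assignment $x$ of integers to the vertices with $x_0=0$, with $x_i\le m$ for every nonroot $v_i$, and with every root edge proper, i.e. $x_i>h_i$ for every nonroot $v_i$. It is proper if moreover $x_j\ne x_i+g$ for every nonroot edge $g e_{ij}$. The number of proper rooted $m$-colorations is $\chi^{\mathbb Z}_\Psi(m)$. $\Psi\setminus e$ is $\Psi$ with the edge $e$ deleted. $\Psi/e$ is defined by top-vertex switching and contraction: orient $e$ from $v_i$ to $v_j$ so that its gain $g=\varphi(e)$ is $\ge 0$; let $\eta_i=g$ and $\eta_k=0$ for all other vertices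 $v_k$ (including $v_j$ and $v_0$); replace the gain $\varphi(f)$ of each edge $f$ oriented from $v_k$ to $v_l$ by $\varphi(f)+\eta_l-\eta_k$ (so $e$ gets gain $0$, and $h_i$ becomes $h_i+g$); then identify $v_i$ and $v_j$ to a single vertex and delete $e$. Other edges joining $v_i$ and $v_j$ become loops. The root edges at the contracted vertex have gain set $(-\infty,\max(h_i+g,h_j)]$. *)

(* Defs.v *)
From HB Require Import structures.
From mathcomp Require Import all_boot all_order all_algebra.
From mathcomp Require Import finmap.
From mathcomp Require Import boolp classical_sets functions cardinality.
From mathcomp Require Import zify.

Set Implicit Arguments.
Unset Strict Implicit.
Unset Printing Implicit Defensive.

Import Order.TTheory GRing.Theory Num.Theory.
Local Open Scope ring_scope.
Local Open Scope classical_set_scope.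

(** An edge carries a reference orientation [src -> tgt] and its gain in that
    direction.  An oriented edge is a pair [(e, b)], where [b = true] means
    that [e] is taken against its reference orientation. *)
Record gain_graph (V E : Type) := GainGraph {
  src : E -> V;
  tgt : E -> V;
  gain : E -> int
}.

Section GainGraph.
Variables (V E : Type) (G : gain_graph V E).

Definition opposite (d : E * bool) : E * bool := (d.1, ~~ d.2).
Definition tail (d : E * bool) : V := if d.2 then tgt G d.1 else src G d.1.
Definition head (d : E * bool) : V := if d.2 then src G d.1 else tgt G d.1.
Definition phi (d : E * bool) : int := if d.2 then - gain G d.1 else gain G d.1.

Lemma phi_opposite d : phi (opposite d) = - phi d.
Proof. by case: d => e [] //=; rewrite /phi /= opprK. Qed.

Lemma tail_opposite d : tail (opposite d) = head d.
Proof. by case: d => e []. Qed.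

Lemma head_opposite d : head (opposite d) = tail d.
Proof. by case: d => e []. Qed.

Definition proper_edge (x : V -> int) (e : E) : Prop :=
  forall b : bool, x (head (e, b)) <> x (tail (e, b)) + phi (e, b).

End GainGraph.

(** The root edges at the nonroot vertex [v] are determined by [height v]
    (the integer h_i), so only the nonroot part and the heights are stored;
    the whole gain graph, with root [None], is [full] below. *)
Record rooted_gain_graph := RootedGainGraph {
  vertex : finType;
  edge : finType;
  nonroot : gain_graph vertex edge;
  height : vertex -> int
}.

Definition root_edge (P : rooted_gain_graph) : Type :=
  {p : vertex P * int | p.2 <= height p.1}.

Definition full (P : rooted_gain_graph) :
    gain_graph (option (vertex P)) (edge P + root_edge P) :=
  GainGraph
    (fun a => match a with
              | inl e => Some (src (nonroot P) e)
              | inr r => None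
              end)
    (fun a => match a with
              | inl e => Some (tgt (nonroot P) e)
              | inr r => Some (val r).1
              end)
    (fun a => match a with
              | inl e => gain (nonroot P) e
              | inr r => (val r).2
              end).

Definition is_link (P : rooted_gain_graph) (e : edge P) : bool :=
  src (nonroot P) e != tgt (nonroot P) e.

Section Colorations.
Variables (P : rooted_gain_graph) (m : int).

Definition rooted_coloration (x : {ffun option (vertex P) -> int}) : Prop :=
  [/\ x None = 0,
      forall v : vertex P, x (Some v) <= m
    & forall r : root_edge P, proper_edge (full P) x (inr r)].

Definition proper_rooted_coloration (x : {ffun option (vertex P) -> int}) :
    Prop :=
  rooted_coloration x /\ forall e : edge P, proper_edge (full P) x (inl e).

Lemma root_edges_properP (x : {ffun option (vertex P) -> int}) :
  x None = 0 ->
  (forall r : root_edge P, proper_edge (full P) x (inr r)) <->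
  (forall v : vertex P, height v < x (Some v)).
Proof.
move=> x0; split=> [xP v | xP [[v g] /= hg] b].
  rewrite ltNge; apply/negP => hx.
  pose r : root_edge P := exist _ (v, x (Some v)) hx.
  by apply: (xP r false); rewrite /head /tail /phi /= x0 add0r.
have := xP v; case: b; rewrite /head /tail /phi /= x0; lia.
Qed.

(** Infinite sets are sent to the empty [fset] by [fset_set], so the
    definition of [chiZ] needs this. *)
Lemma finite_proper_rooted_coloration :
  finite_set [set x | proper_rooted_coloration x].
Proof.
pose B : nat := (`|m| + \sum_(v : vertex P) `|height v|)%N.
pose f (y : {ffun option (vertex P) -> 'I_(B + B).+1}) :
    {ffun option (vertex P) -> int} :=
  [ffun i => (nat_of_ord (y i))%:Z - B%:Z].
apply: (@sub_finite_set _ _ (f @` setT)); last exact/finite_image/finite_finset.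
move=> x [[x0 xm /(root_edges_properP x0) xh] _].
have hB (v : vertex P) : (`|height v| <= \sum_(v : vertex P) `|height v|)%N.
  by rewrite (bigD1 v) //= leq_addr.
have bound i : - B%:Z <= x i <= B%:Z.
  case: i => [v|]; last by rewrite x0 /B; lia.
  have := hB v; have := xm v; have := xh v; rewrite /B.
  move: (\sum_v _)%N => s; lia.
exists [ffun i => inord (absz (x i + B%:Z))] => //.
apply/ffunP => i; rewrite !ffunE inordK; have := bound i; move: (x i) => z; clearbody B; clear; lia.
Qed.

Definition chiZ : nat := #|` fset_set [set x | proper_rooted_coloration x]|.

End Colorations.

Definition delete (P : rooted_gain_graph) (e : edge P) : rooted_gain_graph :=
  @RootedGainGraph (vertex P) {f : edge P | f != e}
    (GainGraph (fun f => src (nonroot P) (val f))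
               (fun f => tgt (nonroot P) (val f))
               (fun f => gain (nonroot P) (val f)))
    (@height P).

(** Switching by [eta], extended by 0 at the root. *)
Definition switch (P : rooted_gain_graph) (eta : vertex P -> int) :
    rooted_gain_graph :=
  @RootedGainGraph (vertex P) (edge P)
    (GainGraph (src (nonroot P)) (tgt (nonroot P))
               (fun f => gain (nonroot P) f + eta (tgt (nonroot P) f)
                         - eta (src (nonroot P) f)))
    (fun v => height v + eta v).

Definition merge (T : finType) (i j : T) (v : T) : T := if v == i then j else v.

(** Identification of the nonroot vertices [i] and [j]: the merged vertex is
    named [j], and [i] disappears (nothing happens if [i = j]). *)
Definition identify (P : rooted_gain_graph) (i j : vertex P) :
    rooted_gain_graph :=
  let V' : finType := {w : vertex P | w \in codom (merge i j)} in
  let q (v : vertex P) : V' := exist _ (merge i j v) (codom_f (merge i j) v) in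
  @RootedGainGraph V' (edge P)
    (GainGraph (fun f => q (src (nonroot P) f))
               (fun f => q (tgt (nonroot P) f))
               (gain (nonroot P)))
    (fun w => if val w == j then Num.max (height i) (height j)
              else height (val w)).

(** The orientation of [e] with nonnegative gain; if the gain is 0, the two
    orientations give isomorphic contractions. *)
Definition top_orientation (P : rooted_gain_graph) (e : edge P) :
    edge P * bool :=
  (e, gain (nonroot P) e < 0).

Definition contract (P : rooted_gain_graph) (e : edge P) : rooted_gain_graph :=
  let d := top_orientation e in
  let i := tail (nonroot P) d in
  let j := head (nonroot P) d in
  let eta v := if v == i then phi (nonroot P) d else 0 in
  @delete (@identify (@switch P eta) i j) e.

Arguments is_link P e : clear implicits.
Arguments delete P e : clear implicits.
Arguments contract P e : clear implicits.

(* Main.v *)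
Require Import Defs.
From mathcomp Require Import all_boot all_order all_algebra.
From mathcomp Require Import finmap.
From mathcomp Require Import boolp classical_sets cardinality.
From mathcomp Require Import zify.
Local Open Scope ring_scope.

(** The proper rooted colorations of [delete P e] are those of [P] together
    with those in which [e] is the only improper nonroot edge.  Orient [e] from
    [i] to [j] with gain [g >= 0]; the latter satisfy [x j = x i + g], so adding
    [g] at [i] makes [x] constant on the identified vertices, which yields the
    colorations of [contract P e].  The upper bound [m] survives in both
    directions because switching at the top vertex only requires
    [x i = x j - g <= x j <= m]. *)

Set Implicit Arguments.
Unset Strict Implicit.
Unset Printing Implicit Defensive.

Import Order.TTheory GRing.Theory Num.Theory.
Local Open Scope classical_set_scope.

Section Properness.
Variables (P : rooted_gain_graph) (m : int).
Implicit Type x : {ffun option (vertex P) -> int}.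

(** Stated in the reference orientation only: reversing an edge turns this equation into an
    equivalent one, so its negation is properness in both orientations. *)
Definition satisfied x (f : edge P) : Prop :=
  x (Some (tgt (nonroot P) f)) = x (Some (src (nonroot P) f)) + gain (nonroot P) f.

Lemma proper_edge_nonroot x f : proper_edge (full P) x (inl f) <-> ~ satisfied x f.
Proof.
rewrite /proper_edge /satisfied /Defs.head /tail /phi /=; split=> [/(_ false)|xf []] //=; lia.
Qed.

Lemma proper_rooted_colorationP x :
  proper_rooted_coloration m x <->
  [/\ x None = 0, forall v, height v < x (Some v) <= m
    & forall f, ~ satisfied x f].
Proof.
split=> [[[x0 xm /(root_edges_properP x0) xh] xP]|[x0 xhm xP]].
  by split=> // [v|f]; [rewrite xh xm | apply/proper_edge_nonroot].
split=> [|f]; last exact/proper_edge_nonroot.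
by split=> // [v|]; [|apply/(root_edges_properP x0) => v]; case/andP: (xhm v).
Qed.

End Properness.

Section DeletionContraction.
Variables (P : rooted_gain_graph) (e : edge P) (m : int).
Hypothesis he : is_link P e.

Let i := tail (nonroot P) (top_orientation e).
Let j := Defs.head (nonroot P) (top_orientation e).
Let g := phi (nonroot P) (top_orientation e).
Let eta (v : vertex P) := if v == i then g else 0.

Lemma top_gain_ge0 : 0 <= g.
Proof. by rewrite /g /phi /=; case: ifP; lia. Qed.

Lemma top_ends_neq : j != i.
Proof.
by move: he; rewrite /is_link /i /j /Defs.head /tail /=; case: ifP => // _; rewrite eq_sym.
Qed.

Lemma satisfied_top (x : {ffun option (vertex P) -> int}) :
  satisfied x e <-> x (Some j) = x (Some i) + g.
Proof.
by rewrite /satisfied /i /j /g /Defs.head /tail /phi /=; case: ifP => _; split; lia.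
Qed.

Lemma merge_idem (v : vertex P) : Defs.merge i j (Defs.merge i j v) = Defs.merge i j v.
Proof. by rewrite /Defs.merge; case: (v =P i) => [_|/eqP/negPf->//]; rewrite (negPf top_ends_neq). Qed.

Lemma merge_neq (v : vertex P) : Defs.merge i j v != i.
Proof. by rewrite /Defs.merge; case: ifP => [_|->//]; exact: top_ends_neq. Qed.

(** The quotient map onto the vertices of the contraction; [val] is a section of it. *)
Definition contracted (v : vertex P) : vertex (contract P e) :=
  exist _ (Defs.merge i j v) (codom_f (Defs.merge i j) v).

Lemma contracted_val (w : vertex (contract P e)) : contracted (val w) = w.
Proof.
apply: val_inj => /=; have /codomP[v ->] := valP w; exact: merge_idem.
Qed.

(** Pulls a coloration back along the quotient map, then undoes the switching; the root is not
    switched. *)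
Definition uncontract (y : {ffun option (vertex (contract P e)) -> int}) :
    {ffun option (vertex P) -> int} :=
  [ffun a => if a is Some v then y (Some (contracted v)) - eta v else y None].

Lemma uncontract_inj : injective uncontract.
Proof.
move=> y z /ffunP yz; apply/ffunP => -[w|]; last by have := yz None; rewrite !ffunE.
by have := yz (Some (val w)); rewrite !ffunE contracted_val => /addIr.
Qed.

Lemma deleteP x :
  proper_rooted_coloration (P := delete P e) m x <->
  [/\ x None = 0, forall v : vertex P, height v < x (Some v) <= m
    & forall f, f != e -> ~ satisfied (P := P) x f].
Proof.
rewrite proper_rooted_colorationP; split=> -[x0 xv xP]; split=> //.
  by move=> f fe; apply: (xP (exist _ f fe)).
by move=> [f fe]; exact: xP.
Qed.

Lemma contractP y :
  proper_rooted_coloration (P := contract P e) m y <->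
  proper_rooted_coloration (P := delete P e) m (uncontract y) /\
  satisfied (P := P) (uncontract y) e.
Proof.
have ji := negPf top_ends_neq; have g0 := top_gain_ge0.
have ij : contracted i = contracted j by apply: val_inj; rewrite /= /Defs.merge eqxx ji.
have uE v : uncontract y (Some v) = y (Some (contracted v)) - eta v by rewrite ffunE.
(* The ends of [e] share one color in [y], and only [i] is lowered, by [g]. *)
have satE : satisfied (P := P) (uncontract y) e.
  by apply/satisfied_top; rewrite !uE ij /eta eqxx ji; lia.
rewrite deleteP proper_rooted_colorationP.
(* Subtracting [eta] from the colors compensates the change of gains made by switching. *)
have fE (f : edge P) (fe : f != e) :
    satisfied (P := contract P e) y (exist _ f fe) <->
    satisfied (P := P) (uncontract y) f.
  have -> : satisfied (P := contract P e) y (exist _ f fe) =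
      (y (Some (contracted (tgt (nonroot P) f))) =
       y (Some (contracted (src (nonroot P) f))) +
         (gain (nonroot P) f + eta (tgt (nonroot P) f) - eta (src (nonroot P) f))) by [].
  by rewrite /satisfied !uE; split; lia.
have hE (w : vertex (contract P e)) : height w = if val w == j
    then Num.max (height i + eta i) (height j + eta j) else @height P (val w) + eta (val w).
  by [].
split=> [[y0 yv yP]|[[y0 yv yP] _]].
  split=> //; split=> [|v|f fe]; first by rewrite ffunE.
    have := yv (contracted v); rewrite uE hE /= /Defs.merge /eta eqxx ji.
    (* At [i] the color drops by [g]: the lower bound holds since the maximum is at least
       [height i + g], the upper bound since [g >= 0]. *)
    have [->|vi] := eqVneq v i; first by rewrite eqxx; lia.
    by have [->|vj] := eqVneq v j; rewrite ?(negPf vi) ?ji; lia.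
  by move/(fE f fe)/yP.
split=> [|w|[f fe] /(fE f fe)]; first by rewrite ffunE in y0.
  have wi : val w != i by have /codomP[v ->] := valP w; exact: merge_neq.
  have := yv (val w); rewrite uE hE contracted_val /eta (negPf wi) eqxx ji.
  case: ifP => [/eqP wj|_]; last lia.
  (* Exceeding the maximum at the merged vertex takes the lower bounds at both [j] and [i]. *)
  have := yv i; rewrite uE ij -wj contracted_val /eta eqxx; lia.
exact: yP.
Qed.

Lemma satisfied_uncontract (x : {ffun option (vertex P) -> int}) :
  x None = 0 -> satisfied (P := P) x e ->
  exists y, uncontract y = x.
Proof.
move=> x0 /satisfied_top xe.
(* Restriction of [x] to the surviving vertices: [i] is not among them, and its color is recovered
   as [x j - g]. *)
exists [ffun a => if a is Some w then x (Some (val w)) else 0].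
apply/ffunP => -[v|]; rewrite !ffunE //= /eta /Defs.merge.
by case: eqP => [->|_]; lia.
Qed.

Lemma delete_colorations :
  [set x | proper_rooted_coloration (P := delete P e) m x] =
  [set x | proper_rooted_coloration (P := P) m x] `|`
  uncontract @` [set y | proper_rooted_coloration (P := contract P e) m y].
Proof.
apply/seteqP; split=> x /=.
  move=> xD; have [x0 xv xP] := (deleteP x).1 xD.
  have [xe|xe] := pselect (satisfied (P := P) x e).
    right; have [y yx] := satisfied_uncontract x0 xe.
    by exists y => //; apply/contractP; rewrite yx.
  left; apply/proper_rooted_colorationP; split=> // f.
  by have [->|/xP] := eqVneq f e.
case=> [/proper_rooted_colorationP[x0 xv xP]|[y /contractP[yD _] <-]] //.
by apply/deleteP; split.
Qed.

Lemma deletion_contraction :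
  chiZ (delete P e) m = (chiZ P m + chiZ (contract P e) m)%N.
Proof.
have finP := @finite_proper_rooted_coloration P m.
have finC := @finite_proper_rooted_coloration (contract P e) m.
have finI := finite_image uncontract finC.
have <- : #|` fset_set (uncontract @`
    [set y | proper_rooted_coloration (P := contract P e) m y])| = chiZ (contract P e) m.
  by rewrite fset_set_image // card_imfset //; exact: uncontract_inj.
(* Inclusion-exclusion reduces the count to showing that the two sets of colorations are disjoint;
   they differ in whether [e] is satisfied. *)
rewrite /chiZ delete_colorations fset_setU // -cardfsUI -fset_setI //.
set I := (X in (_ + #|` fset_set X|)%N).
suff -> : I = set0 by rewrite fset_set0 cardfs0 addn0.
rewrite -subset0 => x [/proper_rooted_colorationP[_ _ /(_ e) xe]].
by case=> y /contractP[_ ye] xy; rewrite xy in ye.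
Qed.

End DeletionContraction.

Theorem theorem3p4 (P : rooted_gain_graph) (e : edge P) (he : is_link P e)
    (m : int) :
  (chiZ P m)%:Z = (chiZ (delete P e) m)%:Z - (chiZ (contract P e) m)%:Z.
Proof. by rewrite (deletion_contraction m he) PoszD addrK. Qed.
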